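(* Let $n\geq 3$ be an integer and let $\mathbb F$ be a field whose algebraic closure $\overline{\mathbb F}$ is a finite extension of $\mathbb F$. Then the commuting graph $\Gamma(M_n(\mathbb F))$ is connected and its diameter is equal to four.
   Context: $M_n(\mathbb F)$ denotes the algebra of all $n\times n$ matrices over the field $\mathbb F$. The commuting graph $\Gamma(M_n(\mathbb F))$ is the simple graph whose vertices are all non-central matrices of $M_n(\mathbb F)$, two distinct vertices $A$ and $B$ being adjacent if and only if $AB=BA$. The distance between two vertices is the length (number of edges) of a shortest path joining them, and the diameter of a connected graph is the supremum of the distances between pairs of vertices. The case $\overline{\mathbb F}=\mathbb F$ is included. *)

(* Defs.v *)
From mathcomp Require Import all_boot all_order all_algebra all_field.

Set Implicit Arguments.
Unset Strict Implicit.
Unset Printing Implicit Defensive.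

Import GRing.Theory.

Local Open Scope ring_scope.

(* The vertices form a Prop-valued predicate on a carrier type rather than a
   sigma type, so that equality of vertices is equality in the carrier. *)
Record sgraph := SGraph {
  carrier : Type;
  vertex : carrier -> Prop;
  adj : carrier -> carrier -> Prop;
  adj_vertex : forall x y, adj x y -> vertex x /\ vertex y;
  adj_sym : forall x y, adj x y -> adj y x;
  adj_irrefl : forall x, ~ adj x x
}.

Section Graph.
Variable G : sgraph.
Implicit Types x y z : carrier G.

(* Vertices may repeat: a walk of minimal length between its endpoints never
   repeats one, so shortest walks and shortest paths are the same thing. *)
Inductive walk : nat -> carrier G -> carrier G -> Prop :=
| walk_nil x : vertex x -> walk 0%N x x
| walk_cons k x y z : adj x y -> walk k y z -> walk k.+1 x z.

Definition connected : Prop :=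
  forall x y, vertex x -> vertex y -> exists k, walk k x y.

Definition is_dist x y (d : nat) : Prop :=
  walk d x y /\ forall k, walk k x y -> (d <= k)%N.

Definition dist_bound (d : nat) : Prop :=
  forall x y k, is_dist x y k -> (k <= d)%N.

(* Supremum of the distances. Pairs in different components have no distance
   and are ignored, so this is meaningful only together with [connected]. *)
Definition is_diameter (d : nat) : Prop :=
  dist_bound d /\ forall e, dist_bound e -> (d <= e)%N.

End Graph.

Section CommutingGraph.
Variables (F : fieldType) (n : nat).
Implicit Types A B : 'M[F]_n.

Definition central_mx A : Prop := forall B, comm_mx A B.

Definition commuting_vertex A : Prop := ~ central_mx A.

Definition commuting_adj A B : Prop :=
  [/\ commuting_vertex A, commuting_vertex B, A <> B & comm_mx A B].

Fact commuting_adj_vertex A B :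
  commuting_adj A B -> commuting_vertex A /\ commuting_vertex B.
Proof. by case. Qed.

Fact commuting_adj_sym A B : commuting_adj A B -> commuting_adj B A.
Proof. by case=> vA vB nAB cAB; split=> // eBA; apply: nAB. Qed.

Fact commuting_adj_irrefl A : ~ commuting_adj A A.
Proof. by case. Qed.

Definition commuting_graph : sgraph :=
  SGraph commuting_adj_vertex commuting_adj_sym commuting_adj_irrefl.

End CommutingGraph.

Definition is_algebraic_closure (F L : fieldType) (iota : {rmorphism F -> L}) :
    Prop :=
  GRing.closed_field_axiom L /\ forall x : L, algebraicOver iota x.

(* Main.v *)
(* Upper bound. If [L] is algebraically closed of finite degree over [F], then
   [\dim L <= 2] (Artin-Schreier): otherwise [L] would be cyclic of prime degree
   over a subfield containing a square root of -1, which is excluded by taking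
   the trace of a solution of [x^p - x = y], resp. the norm of a [q]-th root of
   a Kummer generator. So irreducible polynomials over [F] have degree at most
   two, and every non-scalar matrix [A] commutes with a non-scalar [P] such that
   [P^2 = P] or [P^2 = 0]: a polynomial in [A], or in a matrix of rank at most
   two commuting with [A] when the minimal polynomial of [A] is irreducible.
   Two such matrices [P] and [Q] have a common non-scalar neighbour: either
   [PQ + QP - cP - aQ], or, when that is scalar, a value of rank at most two of
   the Casimir operator of the algebra generated by [P] and [Q]. This gives
   walks A - P - Z - Q - B.
   Lower bound. The Jordan block and its transpose are at distance four, since
   a non-scalar matrix commuting with the former never commutes with a
   non-scalar matrix commuting with the latter. *)
Require Import Defs.
From mathcomp Require Import all_boot all_order all_algebra all_field.
From mathcomp Require Import all_fingroup all_solvable ring zify.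
From HB Require Import structures.

Set Implicit Arguments.
Unset Strict Implicit.
Unset Printing Implicit Defensive.

Import GRing.Theory.

Local Open Scope ring_scope.

(** * Algebraically closed fields of finite degree *)

Section ClosedField.
Variables (L : fieldType) (closedL : GRing.closed_field_axiom L).

Lemma closed_field_root (p : {poly L}) : (1 < size p)%N -> exists x, root p x.
Proof.
move=> p_gt1; have p_neq0: p != 0 by rewrite -size_poly_gt0 ltnW.
have lc_neq0: lead_coef p != 0 by rewrite lead_coef_eq0.
have d_gt0 : (0 < (size p).-1)%N by rewrite -ltnS prednK // ltnW.
have [x Dx] := closedL (fun i => - (p`_i / lead_coef p)) d_gt0.
exists x; apply/rootP; rewrite horner_coef -(prednK (ltnW p_gt1)).
rewrite big_ord_recr /= Dx -lead_coefE mulr_sumr -big_split big1 //= => i _.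
by rewrite mulNr mulrN mulrA mulrCA mulfV // mulr1 subrr.
Qed.

Lemma closed_field_split (p : {poly L}) :
  p \is monic -> exists r : seq L, p == \prod_(y <- r) ('X - y%:P).
Proof.
have [n] := ubnP (size p); elim: n p => // n IHn p /ltnSE le_p_n mon_p.
have [p_gt1 | p_le1] := ltnP 1 (size p).
  have [x /factor_theorem[q Dp]] := closed_field_root p_gt1.
  have mon_q: q \is monic by move: mon_p; rewrite Dp monicMr ?monicXsubC.
  have [|r /eqP Dq] := IHn q _ mon_q.
    move: le_p_n; rewrite Dp size_Mmonic ?monic_neq0 ?monicXsubC //.
    by rewrite size_XsubC addn2.
  by exists (x :: r); rewrite big_cons mulrC -Dq Dp.
exists [::]; rewrite big_nil.
have /size_poly1P[c nz_c Dp]: size p == 1%N.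
  by rewrite eqn_leq p_le1 size_poly_gt0 monic_neq0.
by move: mon_p; rewrite Dp monicE lead_coefC => /eqP->.
Qed.

Lemma closed_field_nth_root n (a : L) : (0 < n)%N -> exists x, x ^+ n = a.
Proof.
move=> n_gt0; have [|x] := closed_field_root (p := 'X^n - a%:P).
  by rewrite size_XnsubC.
by rewrite rootE !hornerE subr_eq0 => /eqP; exists x.
Qed.

Lemma closed_field_sqrtN1 : exists i : L, i ^+ 2 = -1.
Proof. exact: closed_field_nth_root. Qed.

(** A root [z] of 1 + X + ... + X^(q-1) satisfies [z ^+ q = 1], so its order is 1 or [q]; order 1
    would make that sum equal to [q%:R], which is nonzero. *)
Lemma closed_field_prim_root (q : nat) :
  prime q -> q%:R != 0 :> L -> exists z : L, q.-primitive_root z.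
Proof.
move=> q_pr nz_q; have q_gt1 := prime_gt1 q_pr.
have [|z z0] := closed_field_root (p := \poly_(i < q) 1).
  by rewrite size_poly_eq ?oner_eq0.
have {}z0: \sum_(i < q) z ^+ i = 0.
  rewrite -[RHS](rootP z0) horner_poly.
  by apply: eq_bigr => i _; rewrite mul1r.
have zq1: z ^+ q = 1 by apply/eqP; rewrite -subr_eq0 subrX1 z0 mulr0.
have [m prim_z m_dv_q] := prim_order_exists (prime_gt0 q_pr) zq1.
exists z; have /primeP[_ /(_ m m_dv_q)/orP[/eqP m1|/eqP<-//]] := q_pr.
have Dz: z = 1 by rewrite -[z]expr1 -m1 prim_expr_order.
case/eqP: nz_q; rewrite -[RHS]z0 Dz (eq_bigr (fun=> 1)) => [|i _].
  by rewrite sumr_const card_ord.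
exact: expr1n.
Qed.

End ClosedField.

(** * Separability over subfields of an algebraically closed field *)

Section Separable.
Variables (F : fieldType) (L : fieldExtType F).
Implicit Types (K : {subfield L}) (x y z : L).

(** Frobenius sends f(z), with f over [K], to a polynomial in [z ^+ p] whose coefficients are p-th
    powers of elements of [K]. *)
Lemma pFrobenius_adjoin K p y z :
  p \in [pchar L] -> y \in <<K; z>>%VS -> y ^+ p \in <<K; z ^+ p>>%VS.
Proof.
move=> pcharLp /Fadjoin_poly_eq <-; rewrite -(pFrobenius_autE pcharLp).
rewrite horner_coef rmorph_sum; apply: rpred_sum => i _.
rewrite rmorphM rmorphXn /= !pFrobenius_autE.
apply: rpredM; last by rewrite rpredX ?memv_adjoin.
by apply/(subvP (subv_adjoin _ _))/rpredX/polyOverP/Fadjoin_polyOver.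
Qed.

Lemma pFrobenius_adjoin_iter K p e y z :
  p \in [pchar L] -> y \in <<K; z>>%VS ->
  y ^+ (p ^ e) \in <<K; z ^+ (p ^ e)>>%VS.
Proof.
move=> pcharLp Kzy; elim: e => [|e IHe]; first by rewrite expn0 !expr1.
by rewrite expnSr !exprM pFrobenius_adjoin.
Qed.

(* The fields generated over [K] by iterated [p]-th roots of [x] form an
   increasing chain, which must become stationary; Frobenius then transports
   the equality of two consecutive terms back down to [x] and [x ^+ p]. *)
Lemma closed_separable K x :
  GRing.closed_field_axiom L -> separable_element K x.
Proof.
move=> closedL; apply: contraT => insep_x.
have [p pcharLp _] := separablePn_pchar insep_x.
have p_gt0 := prime_gt0 (pcharf_prime pcharLp).
have root_p a : {b : L | b ^+ p == a}.
  apply: sigW; have [b Db] := closed_field_nth_root closedL a p_gt0.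
  by exists b; apply/eqP.
pose r k := iter k (fun a => sval (root_p a)) x.
have rS k : r k.+1 ^+ p = r k by apply/eqP; rewrite /r iterS; case: (root_p _).
have rX k e : r (k + e)%N ^+ (p ^ e) = r k.
  elim: e => [|e IHe]; first by rewrite addn0 expn0 expr1.
  by rewrite addnS expnS exprM rS.
have sub_r k : (<<K; r k>> <= <<K; r k.+1>>)%VS.
  apply/FadjoinP; rewrite subv_adjoin; split=> //.
  by rewrite -rS rpredX ?memv_adjoin.
have [k Dk]: exists k, <<K; r k>>%VS == <<K; r k.+1>>%VS.
  have [/existsP[k Dk]|/existsPn neq_r] :=
    boolP [exists k : 'I_(\dim {:L}).+1, <<K; r k>>%VS == <<K; r k.+1>>%VS].
    by exists k.
  suffices: forall k, (k <= (\dim {:L}).+1 -> k <= \dim <<K; r k>>)%N.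
    by move/(_ _ (leqnn _)); rewrite ltnNge dimvS ?subvf.
  elim=> // k IHk lt_k; apply: leq_ltn_trans (IHk (ltnW lt_k)) _.
  rewrite ltn_neqAle dimvS // andbT.
  have := neq_r (Ordinal lt_k); rewrite eqEdim sub_r /= -ltnNge.
  by rewrite ltn_neqAle => /andP[].
case/negP: insep_x; rewrite (pcharf_p_separable _ _ 0 pcharLp) expn1.
have: r k.+1 \in <<K; r k>>%VS by rewrite (eqP Dk) memv_adjoin.
move/(pFrobenius_adjoin_iter k.+1 pcharLp).
have:= (rX 0%N k, rX 0%N k.+1); rewrite !add0n => -[rk ->].
by rewrite expnSr exprM rk.
Qed.

End Separable.

Lemma big_cycle (R : Type) (idx : R) (op : Monoid.com_law idx)
    (gT : finGroupType) (x : gT) (f : gT -> R) :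
  \big[op/idx]_(y in <[x]>%g) f y = \big[op/idx]_(i < #[x]%g) f (x ^+ i)%g.
Proof.
rewrite (eq_bigl [in [set (x ^+ i)%g | i : 'I_#[x]%g]]) => [|y]; last first.
  apply/idP/imsetP=> [/cyclePmin[i lt_i ->]|[i _ ->]]; last exact: mem_cycle.
  by exists (Ordinal lt_i).
rewrite big_imset //= => i j _ _ /eqP.
by rewrite eq_expg_mod_order !modn_small // => /eqP/val_inj.
Qed.

(** * Cyclic extensions of prime degree with algebraically closed top field *)

Section CyclicPrime.
Variables (F : fieldType) (L : splittingFieldType F).
Hypothesis closedL : GRing.closed_field_axiom L.
Variables (K : {subfield L}) (sigma : gal_of {:L}) (q : nat).
Hypotheses (galK : galois K {:L}) (q_pr : prime q).
Hypotheses (genK : 'Gal({:L} / K)%g = <[sigma]>%g) (o_sigma : #[sigma]%g = q).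

Let K_sub : (K <= {:L})%VS. Proof. exact: subvf. Qed.
Let sigmaG : sigma \in 'Gal({:L} / K)%g. Proof. by rewrite genK cycle_id. Qed.

Let K_fixed y : (y \in K) = (sigma y == y).
Proof.
apply/idP/eqP => [Ky | fix_y]; first exact: fixed_gal K_sub sigmaG Ky.
rewrite -(galois_fixedField galK); apply/fixedFieldP=> [|x].
  exact: memvf.
rewrite genK => /cycleP[j ->]; elim: j => [|j IHj]; first by rewrite gal_id.
by rewrite expgSr galM ?memvf // IHj.
Qed.

(* In characteristic [q], [x ^+ q - x] is onto [L], hence onto [K] by applying
   the trace; this is impossible as [alpha ^+ q - alpha] is in [K] for any
   [alpha] such that [sigma alpha = alpha + 1]. *)
Lemma cyclic_prime_neq_pchar : q%:R != 0 :> L.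
Proof.
apply/eqP=> q0; have pcharLq: q \in [pchar L] by rewrite inE q_pr q0 eqxx.
pose T := galTrace K {:L}.
have T_K y : T y \in K by apply: mem_galTrace; rewrite ?memvf.
have TZ k y : k \in K -> T (k * y) = k * T y.
  move=> Kk; rewrite /T /galTrace mulr_sumr; apply: eq_bigr => x Gx.
  by rewrite rmorphM /= (fixed_gal K_sub Gx Kk).
have TX y : T (y ^+ q) = T y ^+ q.
  rewrite -!(pFrobenius_autE pcharLq) rmorph_sum /=.
  by apply: eq_bigr => x _; rewrite !pFrobenius_autE rmorphXn.
(* By Dedekind's independence of automorphisms the trace is not identically zero. *)
have [theta nz_theta] : exists theta, T theta != 0.
  have [theta _] := @gal_independent_contra _ _ _ [in 'Gal({:L} / K)%g]
    (fun=> 1) _ sigmaG (oner_neq0 _).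
  rewrite (eq_bigr (fun x : gal_of _ => x theta)) => [|x _]; last exact: mul1r.
  by exists theta.
have AS_onto b : b \in K -> exists2 c, c \in K & c ^+ q - c = b.
  (* [y] has trace [b], and the trace of a root of X^q - X - y solves the same equation for [b],
     because [T] commutes with Frobenius. *)
  move=> Kb; pose y := b / T theta * theta.
  have Ty: T y = b by rewrite TZ ?divfK // rpred_div.
  have [|x] := closed_field_root closedL (p := 'X^q - ('X + y%:P)).
    rewrite size_polyDl size_polyXn ?ltnS ?prime_gt0 //.
    by rewrite size_polyN size_XaddC prime_gt1.
  rewrite rootE !hornerE opprD addrA subr_eq0 => /eqP Dy.
  by exists (T x); rewrite // -TX -[LHS](raddfB (galTrace K {:L})) Dy.
pose g i := (sigma ^+ i)%g theta.
have gS i : sigma (g i) = g i.+1 by rewrite /g expgSr galM ?memvf.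
have DT : T theta = \sum_(i < q) g i.
  by rewrite /T /galTrace genK big_cycle o_sigma.
(* An explicit additive Hilbert 90. [sigma] turns [i%:R * g i] into [i.+1%:R * g i.+1 - g i.+1]; the
   first terms add up to the original sum because [q%:R = 0], the second ones to [T theta]. *)
pose alpha : L := - (\sum_(i < q) i%:R * g i) / T theta.
have Dalpha : sigma alpha = alpha + 1.
  have fixT : sigma (T theta) = T theta by apply/eqP; rewrite -K_fixed.
  have: \sum_(0 <= i < q) (i.+1%:R * g i.+1 - i%:R * g i) = 0.
    by rewrite telescope_sumr // q0 !mul0r subr0.
  rewrite big_mkord sumrB => /subr0_eq Dg.
  rewrite /alpha rmorphM fmorphV /= fixT rmorphN rmorph_sum /=.
  rewrite -[X in _ = _ + X](divff nz_theta) -mulrDl; congr (_ / _).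
  rewrite -[X in _ = _ + X]fixT DT rmorph_sum /=.
  rewrite [X in _ = _ + X](eq_bigr (fun i : 'I_q => g i.+1)) => [|i _].
    2: exact: gS.
  rewrite (eq_bigr (fun i : 'I_q => i%:R * g i.+1)) => [|i _]; last first.
    by rewrite rmorphM rmorph_nat /= gS.
  rewrite -Dg -[X in _ = _ + X]opprK -opprD -sumrB; congr (- _).
  by apply: eq_bigr => i _; rewrite -natr1 mulrDl mul1r addrK.
have [c Kc Dc]: exists2 c, c \in K & c ^+ q - c = alpha ^+ q - alpha.
  apply: AS_onto; rewrite K_fixed rmorphB rmorphXn /= Dalpha.
  rewrite -(pFrobenius_autE pcharLq) rmorphD rmorph1 /= pFrobenius_autE.
  by rewrite opprD addrACA subrr addr0.
pose beta : L := alpha - c.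
have Dbeta: beta ^+ q = beta.
  rewrite /beta -(pFrobenius_autE pcharLq) rmorphB /= !pFrobenius_autE.
  by rewrite -(subrK c (c ^+ q)) Dc; ring.
(* X^q - X would have q + 1 roots: the [q] elements of the prime field, and [beta], which is not in
   [K] because [sigma] moves it to [beta + 1]. *)
pose rs := beta :: [seq j%:R | j <- iota 0 q].
have uniq_rs: uniq rs.
  rewrite cons_uniq; apply/andP; split.
    apply/mapP=> -[j _ Dj]; have: beta \in K by rewrite Dj rpred_nat.
    rewrite K_fixed rmorphB /= Dalpha (fixed_gal K_sub sigmaG Kc).
    by rewrite (inj_eq (addIr _)) -subr_eq0 addrAC subrr add0r oner_eq0.
  rewrite map_inj_in_uniq ?iota_uniq // => i j.
  rewrite !mem_iota !add0n => /= lt_i lt_j Dij.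
  wlog le_ij: i j lt_i lt_j Dij / (i <= j)%N.
    by move=> IH; case/orP: (leq_total i j) => /IH->.
  have: (q %| j - i)%N by rewrite (dvdn_pcharf pcharLq) natrB // Dij subrr.
  have [/eqP | gt0] := posnP (j - i).
    by rewrite subn_eq0 => le_ji _; apply/eqP; rewrite eqn_leq le_ij.
  by rewrite gtnNdvd // (leq_ltn_trans (leq_subr _ _)).
pose p : {poly L} := 'X^q - 'X.
have sz_p : size p = q.+1.
  by rewrite size_polyDl ?size_polyXn // size_polyN size_polyX ltnS prime_gt1.
have nz_p : p != 0 by rewrite -size_poly_eq0 sz_p.
have: (size rs < size p)%N.
  apply: max_poly_roots => //; rewrite /= rootE !hornerE Dbeta subrr eqxx /=.
  apply/allP=> _ /mapP[j _ ->]; rewrite rootE !hornerE.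
  by rewrite -(pFrobenius_autE pcharLq) pFrobenius_aut_nat subrr.
by rewrite sz_p /= size_map size_iota ltnn.
Qed.

(* [L] is generated by some [alpha] with [alpha ^+ q] in [K]; the norm [N] of a
   [q]-th root of [alpha] satisfies [N ^+ q = alpha ^+ q] if [q] is odd, and
   [N ^+ 2 = - alpha ^+ 2] if [q = 2]. *)
Lemma cyclic_prime_sqrtN1 (i : L) : i ^+ 2 = -1 -> i \notin K.
Proof.
move=> i2; apply/negP=> Ki.
have [z prim_z] := closed_field_prim_root closedL q_pr cyclic_prime_neq_pchar.
have zq1 := prim_expr_order prim_z.
have sigmaX j y : (sigma ^+ j.+1)%g y = sigma ((sigma ^+ j)%g y).
  by rewrite expgSr galM ?memvf.
have sigmaq : (sigma ^+ q)%g = 1%g by rewrite -o_sigma expg_order.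
(* [sigma z = z ^+ k], and [sigma ^+ q = 1] gives k^q = 1 modulo q; since k^q = k by Fermat, [sigma]
   fixes [z]. *)
have Kz : z \in K.
  have [k Dk] : {k : 'I_q | sigma z = z ^+ k}.
    by apply: (prim_rootP prim_z); rewrite -rmorphXn zq1 rmorph1.
  have Dsigma j : (sigma ^+ j)%g z = z ^+ (k ^ j).
    elim: j => [|j IHj]; first by rewrite gal_id.
    by rewrite sigmaX IHj rmorphXn /= Dk -exprM expnS.
  rewrite K_fixed; have:= Dsigma q; rewrite sigmaq gal_id.
  rewrite Dk => /eqP; rewrite -[X in X == _]expr1 !(eq_prim_root_expr prim_z).
  rewrite fermat_little // => /eqP Dk1.
  by rewrite -[X in _ == X]expr1 (eq_prim_root_expr prim_z) Dk1.
have Nz : galNorm K {:L} z == 1.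
  rewrite /galNorm (eq_bigr (fun=> z)) => [|x Gx]; last first.
    exact: fixed_gal K_sub Gx Kz.
  by rewrite prodr_const genK -orderE o_sigma zq1.
have gen_sigma: generator 'Gal({:L} / K)%g sigma by rewrite /generator genK.
have [alpha [_ nz_alpha] Dz] := Hilbert's_theorem_90 gen_sigma (memvf z) Nz.
have nz_z : z != 0 by rewrite Dz mulf_neq0 ?invr_eq0 ?fmorph_eq0.
have Dalpha : sigma alpha = alpha / z.
  by rewrite Dz invf_div mulrCA mulfV // mulr1.
have notKalpha : alpha \notin K.
  rewrite K_fixed Dalpha -subr_eq0 -{2}[alpha]mulr1 -mulrBr mulf_neq0 //.
  rewrite subr_eq0 invr_eq1; apply: contraTneq (prime_gt1 q_pr) => z1.
  by rewrite -leqNgt dvdn_leq // (prim_order_dvd prim_z) z1 expr1.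
have [beta Dbeta] := closed_field_nth_root closedL alpha (prime_gt0 q_pr).
pose N := galNorm K {:L} beta.
have KN : N \in K by apply: mem_galNorm; rewrite ?memvf.
have nzN : N != 0.
  rewrite galNorm_eq0; apply: contraNneq nz_alpha => b0.
  by rewrite -Dbeta b0 expr0n; case: q q_pr.
(* The conjugates of [alpha] are the [alpha / z ^+ j] for [j < q], and the binomial is the sum of
   these [j]. For odd [q] it is a multiple of [q], so the power of [z] disappears. *)
have DN : N ^+ q = alpha ^+ q / z ^+ 'C(q, 2).
  rewrite /N -galNormX Dbeta /galNorm genK big_cycle o_sigma.
  rewrite (eq_bigr (fun j : 'I_q => alpha / z ^+ j)) => [|j _].
    rewrite prodf_div prodr_const card_ord.
    by rewrite -(big_mkord xpredT (fun j => z ^+ j)) prodrXr bin2_sum.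
  elim: {j}(val j) => [|j IHj]; first by rewrite gal_id expr0 divr1.
  rewrite sigmaX IHj rmorphM fmorphV rmorphXn /= Dalpha.
  by rewrite (fixed_gal K_sub sigmaG Kz) exprS invfM mulrA.
case/negP: notKalpha.
have [q2 | odd_q] := even_prime q_pr.
  have zN1: z = -1.
    move: prim_z zq1; rewrite q2 => prim_z /eqP.
    rewrite sqrf_eq1 => /orP[]/eqP// z1.
    by have:= prim_order_dvd prim_z 1; rewrite z1 expr1 eqxx.
  have: (N == i * alpha) || (N == - (i * alpha)).
    move: DN; rewrite q2 zN1 expr1 invrN1 mulrN1 -eqf_sqr => ->.
    by rewrite exprMn i2 mulN1r.
  have nz_i: i != 0 by rewrite -sqrf_eq0 i2 oppr_eq0 oner_eq0.
  case/orP=> /eqP DN'.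
    by rewrite -[alpha](mulKf nz_i) -DN' rpredM ?rpredV.
  by rewrite -[alpha](mulKf nz_i) -[i * _]opprK -DN' rpredM ?rpredV ?rpredN.
have: (alpha / N) ^+ q = 1.
  rewrite expr_div_n DN bin2odd // exprM zq1 expr1n divr1 divff //.
  by rewrite expf_neq0.
move/(prim_rootP prim_z) => [k Dk].
by rewrite -[alpha](divfK nzN) Dk rpredM ?rpredX.
Qed.

End CyclicPrime.

(** [L] is Galois over F(i). A nontrivial Galois group would have a subgroup of prime order by
    Cauchy, and its fixed field would contain [i], against [cyclic_prime_sqrtN1]. So [L] is F(i). *)
Lemma closed_splitting_dim (F : fieldType) (L : splittingFieldType F) :
  GRing.closed_field_axiom L -> (\dim {:L} <= 2)%N.
Proof.
move=> closedL; have [i i2] := closed_field_sqrtN1 closedL.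
pose K : {subfield L} := <<1; i>>%AS.
have Ki : i \in K by apply: memv_adjoin.
have galK : galois K {:L}.
  rewrite /galois subvf normalFieldf andbT.
  by apply/separableP=> y _; apply: closed_separable.
have dimK : (\dim K <= 2)%N.
  rewrite /K dim_Fadjoin dimv1 muln1 -ltnS -size_minPoly.
  have sz_p : size ('X^2 + 1%:P : {poly L}) = 3%N by rewrite size_XnaddC.
  rewrite -sz_p; apply: dvdp_leq; first by rewrite -size_poly_eq0 sz_p.
  apply: minPoly_dvdp; last by rewrite rootE !hornerE i2 addNr.
  by rewrite rpredD ?rpredX ?polyOverX ?polyOverC ?mem1v.
have Gal1 : #|'Gal({:L} / K)%g| = 1%N.
  apply: contraTeq Ki => ntG.
  have q_pr : prime (pdiv #|'Gal({:L} / K)%g|).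
    by rewrite pdiv_prime // ltn_neqAle eq_sym ntG cardG_gt0.
  have [x Gx o_x] := Cauchy q_pr (pdiv_dvd _).
  have galE : galois (fixedField <[x]>%g) {:L} by apply: fixedField_galois.
  have := cyclic_prime_sqrtN1 closedL galE q_pr (gal_fixedField _) o_x i2.
  apply: contra; apply/subvP; rewrite -galois_connection ?subvf //.
  by rewrite cycle_subG.
by rewrite -(divnK (field_dimS (subvf K))) galois_dim // Gal1 mul1n.
Qed.

(** Minimal polynomials split over [L], which equips [L] with the splitting field structure that
    Galois theory asks for. *)
Lemma closed_dim (F : fieldType) (L : fieldExtType F) :
  GRing.closed_field_axiom L -> (\dim {:L} <= 2)%N.
Proof.
move=> closedL.
have splitL (K : {subfield L}) x :
    exists r, minPoly K x == \prod_(y <- r) ('X - y%:P).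
  exact/(closed_field_split closedL)/monic_minPoly.
pose splitM := FieldExt_isNormalSplittingField.Build F L splitL.
pose L' : splittingFieldType F := HB.pack L splitM.
exact: (@closed_splitting_dim F L').
Qed.

(** * Pairs of quadratic matrices *)

Ltac mx_expand :=
  rewrite ?(mulrDl, mulrDr, mulrBl, mulrBr, mulNr, mulrN, mul1r, mulr1,
            =^~ scalerAl, =^~ scalerAr, mulrA).

(* [ring] only handles commutative rings: to compare two linear combinations of
   products of matrices, the products are generalized and entries compared. *)
Ltac mx_linear :=
  rewrite -?mulmxE;
  repeat match goal with |- context [@mulmx ?R ?m ?n ?p ?x ?y] =>
    generalize (@mulmx R m n p x y) => ?
  end;
  apply/matrixP=> ? ?; rewrite !mxE; ring.

Section Quadratic.
Variables (F : fieldType) (n : nat).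
Implicit Types (P Q X D : 'M[F]_n.+1) (a b c : F).

(** Both products reduce to [P * D * P + b *: D]. *)
Lemma quadratic_commutes P a b D : P * P = a *: P + b *: 1 ->
  GRing.comm P (P * D + D * P - a *: D).
Proof.
move=> PP.
have PPD: P * P * D = a *: (P * D) + b *: D by rewrite PP; mx_expand.
have DPP: D * P * P = a *: (D * P) + b *: D by rewrite -mulrA PP; mx_expand.
rewrite /GRing.comm; mx_expand; rewrite PPD DPP. mx_linear.
Qed.

Section Relation.
Variables (P Q : 'M[F]_n.+1) (a c z : F).
Hypotheses (PP : P * P = a *: P) (QQ : Q * Q = c *: Q).

(** Both products reduce to [P * Q * P - c *: (P * P)]. Exchanging [P], [a] with [Q], [c] preserves
    the expression, so commutation with [Q] follows by symmetry. *)
Lemma anticommutator_comm_l :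
  GRing.comm P (P * Q + Q * P - (c *: P + a *: Q)).
Proof.
have PPQ: P * P * Q = a *: (P * Q) by rewrite PP; mx_expand.
have QPP: Q * P * P = a *: (Q * P) by rewrite -mulrA PP; mx_expand.
by rewrite /GRing.comm; mx_expand; rewrite PPQ QPP; mx_linear.
Qed.

Hypothesis PQ : P * Q + Q * P = c *: P + a *: Q + z *: 1.
Variable X : 'M[F]_n.+1.
Let D := Q * X - X * Q.
(* This is [\sum_i e_i * X * e_i'] for the basis [1, P, Q, PQ] and its dual for
   the bilinear form taking [(x, y)] to the [PQ]-coefficient of [xy]. *)
Definition casimir := P * D + D * P - a *: D.

Lemma casimir_comm_l : GRing.comm P casimir.
Proof. by apply: (@quadratic_commutes P a 0); rewrite scale0r addr0. Qed.

Let QP : Q * P = c *: P + a *: Q + z *: 1 - P * Q.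
Proof. by rewrite -PQ addrC addKr. Qed.

(** The commutator [D] satisfies [Q * D + D * Q = c *: D] because [Q * Q = c *: Q]; this and the
    relation [PQ] let [Q] pass through each term. *)
Lemma casimir_comm_r : GRing.comm Q casimir.
Proof.
have QD : Q * D = c *: D - D * Q.
  have QQX : Q * Q * X = c *: (Q * X) by rewrite QQ; mx_expand.
  have XQQ : X * Q * Q = c *: (X * Q) by rewrite -mulrA QQ; mx_expand.
  by rewrite /D; mx_expand; rewrite QQX XQQ; mx_linear.
rewrite /GRing.comm /casimir; move: D QD => D' QD.
have QPD : Q * P * D' = c *: (P * D') + a *: (Q * D') + z *: D' - P * (Q * D').
  by rewrite QP; mx_expand.
have QDP : Q * D' * P = c *: (D' * P) - D' * (Q * P) by rewrite QD; mx_expand.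
mx_expand; rewrite QPD QDP QD QP; mx_expand; mx_linear.
Qed.

Hypothesis PX : P * X = 0.

(** Each of the two summands has a factor [X], so the value has rank at most two when [X] has rank
    at most one. *)
Lemma casimirE : casimir = X * (z *: 1 - Q * P + a *: Q) + Q * X * P.
Proof.
have PQX : P * Q * X = a *: (Q * X) + z *: X.
  rewrite (canRL (addrK _) PQ); mx_expand.
  by rewrite -[Q * P * X]mulrA PX mulr0 scaler0 subr0 add0r.
have PXQ : P * X * Q = 0 by rewrite PX mul0r.
by rewrite /casimir /D; mx_expand; rewrite PQX PXQ; mx_linear.
Qed.

Lemma mul_casimir : P * casimir = P * Q * X * P.
Proof.
have PXQ : P * X * Q = 0 by rewrite PX mul0r.
have PPD Y : P * (P * Y + Y * P - a *: Y) = P * Y * P.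
  have PPY : P * P * Y = a *: (P * Y) by rewrite PP -scalerAl.
  by mx_expand; rewrite PPY; mx_linear.
by rewrite /casimir PPD /D; mx_expand; rewrite PXQ mul0r subr0.
Qed.

End Relation.

(** If [A i k] and [B l j] are nonzero, entry (i, j) of [A * delta_mx k l * B] is their product. *)
Lemma delta_mx_sandwich_neq0 (A B : 'M[F]_n.+1) :
  A != 0 -> B != 0 -> exists i j, A * delta_mx i j * B != 0.
Proof.
move=> /matrix0Pn[i [k Aik]] /matrix0Pn[l [j Blj]]; exists k, l.
apply/matrix0Pn; exists i, j; rewrite -mulmxE -(mul_delta_mx (0 : 'I_1)).
rewrite mulmxA -mulmxA -colE -rowE !mxE big_ord1 !mxE.
by rewrite mulf_neq0.
Qed.

Lemma rank_scalar_mx (A : 'M[F]_n.+1) :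
  is_scalar_mx A -> A != 0 -> \rank A = n.+1.
Proof.
case/is_scalar_mxP=> c -> nz_c; apply: mxrank_unit; rewrite unitmxE det_scalar.
by rewrite unitfE expf_neq0 //; apply: contraNneq nz_c => ->; rewrite raddf0.
Qed.

Lemma nonscalar_neq0 (A : 'M[F]_n.+1) : ~~ is_scalar_mx A -> A != 0.
Proof. by apply: contraNneq => ->; apply: mx0_is_scalar. Qed.

Hypothesis n_gt1 : (1 < n)%N.

Lemma low_rank_nonscalar (A : 'M[F]_n.+1) :
  (\rank A <= 2)%N -> A != 0 -> ~~ is_scalar_mx A.
Proof.
move=> rA nzA; apply: contraTN rA => /rank_scalar_mx->//.
by rewrite -ltnNge.
Qed.

Definition common_neighbour P Q :=
  exists Z, [/\ ~~ is_scalar_mx Z, GRing.comm P Z & GRing.comm Q Z].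

Lemma common_neighbour_casimir P Q U a c : P * P = a *: P -> Q * Q = c *: Q ->
    P * U = 0 ->
    (forall z, P * Q + Q * P = c *: P + a *: Q + z *: 1 -> P * Q * U != 0) ->
  P != 0 -> common_neighbour P Q.
Proof.
move=> PP QQ PU PQU nzP; pose Z := P * Q + Q * P - (c *: P + a *: Q).
have [/is_scalar_mxP[z DZ]|nsZ] := boolP (is_scalar_mx Z); last first.
  exists Z; split=> //; first exact: anticommutator_comm_l.
  rewrite /Z [P * Q + _]addrC [c *: P + _]addrC.
  exact: anticommutator_comm_l.
have PQ : P * Q + Q * P = c *: P + a *: Q + z *: 1.
  rewrite -[LHS](subrK (c *: P + a *: Q)) -/Z DZ addrC.
  by rewrite -[1]/(1%:M) scale_scalar_mx mulr1.
(* The elementary matrix is chosen to make [P * Q * X * P] nonzero; by [mul_casimir] the Casimir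
   value at [X] is then nonzero too, and its low rank keeps it from being scalar. *)
have [j [i nzX]] := delta_mx_sandwich_neq0 (PQU z PQ) nzP.
pose X := U * delta_mx j i.
have rX : (\rank X <= 1)%N.
  by apply: leq_trans (mxrankM_maxr _ _) _; rewrite mxrank_delta.
have PX : P * X = 0 by rewrite mulrA PU mul0r.
have nzY : casimir P Q a X != 0.
  apply: contraNneq nzX => Y0; have := mul_casimir Q PP PX.
  by rewrite Y0 mulr0 /X !mulrA => <-.
exists (casimir P Q a X); split.
- apply: low_rank_nonscalar => //; rewrite (casimirE PQ PX).
  apply: leq_trans (mxrank_add _ _) _; apply: (@leq_add _ _ 1 1).
    exact: leq_trans (mxrankM_maxl _ _) _.
  exact: leq_trans (mxrankM_maxl _ _) (leq_trans (mxrankM_maxr _ _) _).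
- exact: casimir_comm_l.
- exact: casimir_comm_r QQ PQ X.
Qed.

(** If the block [P * Q * (1 - P)] is nonzero, the Casimir construction applies with [U = 1 - P]; if
    [(1 - P) * Q * P] is, it applies to [1 - P] with [U = P]. If both vanish, [P] commutes with [Q]
    and serves itself. *)
Lemma common_neighbour_idempotent P Q c :
    ~~ is_scalar_mx P -> P * P = P -> Q * Q = c *: Q -> common_neighbour P Q.
Proof.
move=> nsP PP QQ; have P'P' : (1 - P) * (1 - P) = 1 - P.
  by mx_expand; rewrite PP; mx_linear.
have nsP' : ~~ is_scalar_mx (1 - P).
  apply: contra nsP => /is_scalar_mxP[a Da]; apply/is_scalar_mxP.
  exists (1 - a); rewrite raddfB /= -Da opprB addrC subrK //.
have [PQP'|] := eqVneq (P * Q * (1 - P)) 0; last first.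
  move=> PQP'; apply: (@common_neighbour_casimir P Q (1 - P) 1 c) => //.
  - by rewrite scale1r.
  - by mx_expand; rewrite PP; mx_linear.
  - exact: nonscalar_neq0.
have [P'QP|P'QP] := eqVneq ((1 - P) * Q * P) 0.
  exists P; split=> //; apply/eqP; rewrite -subr_eq0.
  move: PQP' P'QP; mx_expand => /subr0_eq PQ /subr0_eq QP.
  by rewrite PQ QP subrr.
have [||||Z [nsZ P'Z QZ]] := @common_neighbour_casimir (1 - P) Q P 1 c _ QQ.
- by rewrite scale1r.
- by mx_expand; rewrite PP; mx_linear.
- by [].
- exact: nonscalar_neq0.
exists Z; split=> //; rewrite -[P](subKr 1).
by apply/commr_sym/commrB; [apply: commr1 | apply: commr_sym].
Qed.

(** If [P * Q + Q * P] vanishes, [P] or [P * Q] serves, according to whether [P * Q] is zero.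
    Otherwise take [U = P]: if the anticommutator is a scalar [z], then [P * Q * P = z *: P] with
    [z] nonzero. *)
Lemma common_neighbour_nilpotent P Q :
  ~~ is_scalar_mx P -> P * P = 0 -> Q * Q = 0 -> common_neighbour P Q.
Proof.
move=> nsP PP QQ.
have nzP := nonscalar_neq0 nsP.
have [PQ | nPQ] := eqVneq (P * Q + Q * P) 0.
  have QP : Q * P = - (P * Q) by apply/eqP; rewrite -addr_eq0 addrC PQ.
  have [PQ0 | nzPQ] := eqVneq (P * Q) 0.
    by exists P; split=> //; rewrite /GRing.comm QP PQ0 oppr0.
  exists (P * Q); split.
  - apply: contra nzPQ => /is_scalar_mxP[c Dc].
    have: P * (P * Q) = 0 by rewrite mulrA PP mul0r.
    rewrite Dc -mulmxE mul_mx_scalar => /eqP.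
    rewrite scaler_eq0 (negPf nzP) orbF.
    by move/eqP->; rewrite raddf0.
  - rewrite /GRing.comm !mulrA PP mul0r -mulrA QP.
    by rewrite mulrN mulrA PP mul0r oppr0.
  - by rewrite /GRing.comm mulrA QP mulNr -!mulrA QQ mulr0 oppr0.
apply: (@common_neighbour_casimir P Q P 0 0); rewrite ?scale0r //.
move=> z; rewrite !add0r => PQ.
have -> : P * Q * P = z *: P.
  have := congr1 (fun Y => P * Y) PQ.
  by rewrite mulrDr !mulrA PP mul0r add0r -scalerAr mulr1.
rewrite scaler_eq0 (negPf nzP) orbF; apply: contraNneq nPQ => z0.
by rewrite PQ z0 scale0r.
Qed.
End Quadratic.

(** * Idempotent or square-zero matrices commuting with a given one *)

Definition has_quadratic_factors (F : fieldType) :=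
  forall p : {poly F}, (1 < size p)%N ->
    exists q : {poly F}, [/\ irreducible_poly q, (size q <= 3)%N & q %| p].

(** The factor is the minimal polynomial over [F] of a root of [p] in [L]; [closed_dim] bounds its
    degree. *)
Lemma closed_quadratic_factors (F : fieldType) (L : fieldExtType F) :
  GRing.closed_field_axiom L -> has_quadratic_factors F.
Proof.
move=> closedL p p_gt1; pose iota := in_alg L.
have [|x px0] := closed_field_root closedL (p := map_poly iota p).
  by rewrite size_map_poly.
have /polyOver1P[q Dq] := minPolyOver 1%AS x.
have szq : size q = size (minPoly 1%AS x) by rewrite Dq size_map_poly.
exists q; split; last 1 first.
- rewrite -(dvdp_map iota) -Dq minPoly_dvdp //.
  by apply/polyOver1P; exists p.
- split=> [|d d_neq1 dv_d].
    by rewrite szq size_minPoly.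
  have dK : map_poly iota d \is a polyOver 1%VS by apply/polyOver1P; exists d.
  have := @minPoly_irr _ _ _ x _ dK; rewrite Dq (dvdp_map iota) => /(_ dv_d).
  rewrite !(eqp_map iota) -[1](rmorph1 (map_poly iota)) (eqp_map iota).
  by rewrite -size_poly_eq1 (negPf d_neq1) orbF.
- rewrite szq size_minPoly ltnS adjoin_degreeE dimv1 divn1.
  by apply: leq_trans (closed_dim closedL); apply: dimvS (subvf _).
Qed.

Lemma central_is_scalar (R : pzRingType) n (A : 'M[R]_n.+1) :
  (forall i j, comm_mx A (delta_mx i j)) -> is_scalar_mx A.
Proof.
move=> cA; apply/is_scalar_mxP; exists (A 0 0); apply/matrixP=> i j.
have /matrixP/(_ i 0) := cA j 0.
rewrite -(mul_delta_mx (0 : 'I_1)) mulmxA -colE -mulmxA -rowE !mxE !big_ord1.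
by rewrite !mxE !eqxx mulr1 andbT mulr_natl => ->.
Qed.

Section QuadraticNeighbour.
Variables (F : fieldType) (n : nat).
Implicit Types A B P : 'M[F]_n.+1.

(** Write the minimal polynomial as [s * q]. If [q] divides [s], the value of [s] at [A] squares to
    zero and is nonzero by degree. Otherwise [u * q + v * s = 1] makes [u * q] idempotent modulo
    [s * q]; a scalar value would have to be 0, and [s] would be constant. *)
Lemma polynomial_neighbour A (q : {poly F}) :
    irreducible_poly q -> q %| mxminpoly A -> ~~ (mxminpoly A %| q) ->
  exists p, let P := horner_mx A p in
    ~~ is_scalar_mx P /\ (P * P = P \/ P * P = 0).
Proof.
move=> irr_q q_dv_m nm_dv_q; set m := mxminpoly A in q_dv_m nm_dv_q *.
have nz_m : m != 0 by rewrite monic_neq0 ?mxminpoly_monic.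
have [s Dm] := dvdpP _ _ q_dv_m.
have nz_s : s != 0 by apply: contraNneq nz_m => s0; rewrite Dm s0 mul0r.
have q_gt1 : (1 < size q)%N := irr_q.1.
have nz_q : q != 0 by rewrite -size_poly_gt0 ltnW.
have mP p : m %| p -> horner_mx A p = 0 by move/mxminpoly_minP.
have [q_dv_s | nq_dv_s] := boolP (q %| s).
  exists s => P; have PP : P * P = 0.
    by rewrite /P -rmorphM /= mP // Dm dvdp_mul.
  have nzP : P != 0.
    rewrite /P -dvd_mxminpoly -/m; apply: contraTN q_gt1 => /(dvdp_leq nz_s).
    rewrite Dm size_mul // -leqNgt; move: nz_s; rewrite -size_poly_gt0.
    move: (size s) (size q) => i j; lia.
  split; last by right.
  apply: contra nzP => /is_scalar_mxP[c Dc].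
  move/eqP: PP; rewrite {1}Dc -mulmxE mul_scalar_mx scaler_eq0.
  case/orP=> [/eqP c0|//].
  by rewrite Dc c0 raddf0.
have [[u v] /= Duv] : exists u, u.1 * q + u.2 * s = 1.
  by apply/Bezout_eq1_coprimepP; rewrite irreducible_poly_coprime.
exists (u * q); set P := horner_mx A _; rewrite /=; split; last first.
  left; apply/eqP; rewrite -subr_eq0 /P -rmorphM -rmorphB /= mP //.
  have -> : u * q * (u * q) - u * q = - (u * v) * (s * q).
    have Dvs : v * s = 1 - u * q by rewrite -Duv addrC addKr.
    by transitivity (- (u * q) * (v * s)); [rewrite Dvs|]; ring.
  by rewrite Dm dvdp_mull.
apply/negP=> /is_scalar_mxP[c Dc].
have m_dv : m %| u * q - c%:P.
  by apply/mxminpoly_minP; rewrite rmorphB /= horner_mx_C -/P Dc subrr.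
have c0 : c = 0.
  apply: contraTeq q_gt1 => nz_c; rewrite -leqNgt.
  have: q %| c%:P.
    by rewrite -(dvdp_subr _ (dvdp_mull u (dvdpp q))) (dvdp_trans q_dv_m).
  by move/dvdp_leq; rewrite polyC_eq0 size_polyC nz_c => ->.
case/negP: nm_dv_q; have: s %| 1.
  rewrite -Duv; apply: dvdp_add; last exact: dvdp_mull.
  rewrite -[u * q]subr0 -[0](polyC0 F) -c0.
  by apply: dvdp_trans m_dv; rewrite Dm dvdp_mulr.
rewrite dvdp1 => /size_poly1P[k nz_k Ds].
by rewrite Dm Ds mul_polyC dvdpZl.
Qed.

(** [phi] maps into the commutant of [A] and takes elementary matrices to rank at most two. If it
    kills all of them, it also kills 1, and [phi X - X * phi 1 = A * X - X * A] makes [A]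
    central. *)
Lemma quadratic_low_rank_neighbour A a b : (1 < n)%N ->
    ~~ is_scalar_mx A -> A * A = a *: A + b *: 1 ->
  exists B, [/\ ~~ is_scalar_mx B, GRing.comm A B & (\rank B <= 2)%N].
Proof.
move=> n_gt1 nsA AA; pose phi X : 'M_n.+1 := A * X + X * A - a *: X.
have [nz|/existsPn phi0] := boolP [exists ij, phi (delta_mx ij.1 ij.2) != 0].
  have [[i j] /= nz_phi] := existsP nz.
  have rphi : (\rank (phi (delta_mx i j)) <= 2)%N.
    have -> : phi (delta_mx i j) =
        A * delta_mx i j + delta_mx i j * (A - a *: 1).
      by rewrite /phi; mx_expand; mx_linear.
    apply: leq_trans (mxrank_add _ _) _; apply: (@leq_add _ _ 1 1).
      by apply: leq_trans (mxrankM_maxr _ _) _; rewrite mxrank_delta.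
    by apply: leq_trans (mxrankM_maxl _ _) _; rewrite mxrank_delta.
  exists (phi (delta_mx i j)); split=> //; first exact: low_rank_nonscalar.
  exact: quadratic_commutes AA.
have {}phi0 i j : phi (delta_mx i j) = 0.
  by apply/eqP; have := phi0 (i, j); rewrite negbK.
have phi1 : phi 1 = 0.
  rewrite /phi -[1]/(1%:M) mx1_sum_delta mulr_sumr mulr_suml scaler_sumr.
  by rewrite -big_split -sumrB big1 // => i _; apply: phi0.
case/negP: nsA; apply: central_is_scalar => i j.
have phiE X : A * X - X * A = phi X - X * phi 1.
  by rewrite /phi; mx_expand; mx_linear.
by have := phiE (delta_mx i j); rewrite phi0 phi1 mulr0 subr0 => /subr0_eq.
Qed.

Lemma idempotent_or_nilpotent_neighbour A :
    (1 < n)%N -> has_quadratic_factors F ->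
    ~~ is_scalar_mx A ->
  exists P, [/\ ~~ is_scalar_mx P, GRing.comm A P & P * P = P \/ P * P = 0].
Proof.
move=> n_gt1 irrF nsA; pose m B := mxminpoly B.
have sz_m B : ~~ is_scalar_mx B -> (2 < size (m B))%N.
  by rewrite size_mxminpoly -mxminpoly_linear_is_scalar -ltnNge.
have poly_case B q : irreducible_poly q -> q %| m B -> ~~ (m B %| q) ->
    GRing.comm A B ->
  exists P, [/\ ~~ is_scalar_mx P, GRing.comm A P & P * P = P \/ P * P = 0].
  move=> irr_q q_dv nm_dv cAB.
  have [p [nsP sqP]] := polynomial_neighbour irr_q q_dv nm_dv.
  by exists (horner_mx B p); split=> //; apply: comm_mx_horner.
have [q [irr_q szq q_dv]] := irrF (m A) (ltnW (sz_m A nsA)).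
have [m_dv|nm_dv] := boolP (m A %| q).
  2: exact: poly_case irr_q q_dv nm_dv _.
have sz3 : size (m A) = 3%N.
  apply/eqP; rewrite eqn_leq sz_m // andbT (leq_trans (dvdp_leq _ m_dv)) //.
  exact: irredp_neq0.
have mA2 : (m A)`_2 = 1.
  by have /monicP := mxminpoly_monic A; rewrite lead_coefE sz3.
have AA : A * A = - (m A)`_1 *: A + - (m A)`_0 *: 1.
  have Dm : m A = 'X * 'X + ((m A)`_1)%:P * 'X + ((m A)`_0)%:P.
    rewrite -[LHS]coefK poly_def sz3 !big_ord_recl big_ord0 /= mA2.
    by rewrite -!mul_polyC; ring.
  have := mx_root_minpoly A; rewrite -/(m A) [X in horner_mx A X]Dm.
  have E1 : ((m A)`_1)%:M * A = (m A)`_1 *: A by apply: mul_scalar_mx.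
  have E0 : ((m A)`_0)%:M = (m A)`_0 *: 1 :> 'M_n.+1.
    by rewrite -[1]/(1%:M) scale_scalar_mx mulr1.
  rewrite !(rmorphD, rmorphM) /= !horner_mx_C horner_mx_X E1 E0 -addrA.
  by move/(canRL (addrK _)) ->; rewrite add0r opprD !scaleNr.
have [B [nsB cAB rB]] := quadratic_low_rank_neighbour n_gt1 nsA AA.
(* [B] is singular since its rank is below [n.+1], so X divides its minimal polynomial, which has
   degree at least two because [B] is not scalar. *)
have q_dv_B : 'X - 0%:P %| m B.
  rewrite dvdp_XsubCl -eigenvalue_root_min /eigenvalue /eigenspace raddf0 subr0.
  by rewrite kermx_eq0 /row_free neq_ltn (leq_ltn_trans rB).
apply: poly_case (irredp_XsubC 0) q_dv_B _ cAB; apply/negP=> /dvdp_leq.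
by rewrite polyXsubC_eq0 size_XsubC leqNgt sz_m // => /(_ isT).
Qed.

End QuadraticNeighbour.

(** * Commutants of a Jordan block and of its transpose *)

Section Jordan.
Variables (F : fieldType) (n : nat).
Implicit Types X Y : 'M[F]_n.+1.

Definition jordan_mx : 'M[F]_n.+1 := \matrix_(i, j) (j == i.+1 :> nat)%:R.

(** Entry (i, j) of the commutation relation reads [X i.+1 j = X i j.-1], with 0 on the right when
    [j = 0]; induction on the row follows. *)
Lemma jordan_comm_toeplitz X : comm_mx jordan_mx X ->
  forall i j : 'I_n.+1, X i j = if (i <= j)%N then X 0 (inord (j - i)) else 0.
Proof.
move=> cX [i lt_i]; elim: i lt_i => [|i IHi] lt_i j /=.
  by rewrite subn0 inord_val; congr (X _ _); apply: val_inj.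
have lt_i' := ltnW lt_i; pose i' := Ordinal lt_i'.
have /matrixP/(_ i' j) := cX; rewrite !mxE (bigD1 (Ordinal lt_i)) //=.
rewrite !mxE eqxx mul1r big1 ?addr0 => [->|s neq_s]; last first.
  rewrite mxE; case: eqP => [Ds|_]; last by rewrite mul0r.
  by case/eqP: neq_s; apply: val_inj.
case: (posnP j) => [j0|j_gt0].
  by rewrite j0 big1 // => s _; rewrite mxE j0 mulr0.
have lt_j' : (j.-1 < n.+1)%N by rewrite (leq_ltn_trans (leq_pred j)).
rewrite (bigD1 (Ordinal lt_j')) //= mxE /= prednK // eqxx mulr1 IHi /=.
rewrite big1 ?addr0 => [|s neq_s]; last first.
  rewrite mxE; case: eqP => [Ds|_]; last by rewrite mulr0.
  by case/eqP: neq_s; apply: val_inj; rewrite /= Ds.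
by rewrite -ltnS prednK // -subn1 -subnDA add1n.
Qed.

(** [c] is the diagonal value and [k] the first superdiagonal on which the Toeplitz matrix [X] does
    not vanish. *)
Lemma jordan_comm_band X : comm_mx jordan_mx X -> ~~ is_scalar_mx X ->
  exists c k, [/\ (0 < k <= n)%N,
    forall i j : 'I_n.+1, (j < i + k)%N -> (X - c%:M) i j = 0 &
    forall i j : 'I_n.+1, j = (i + k)%N :> nat -> (X - c%:M) i j != 0].
Proof.
move=> cX nsX; have XE := jordan_comm_toeplitz cX.
pose x k := X 0 (inord k).
have X'E (i j : 'I_n.+1) :
    (X - (x 0)%:M) i j = if (i < j)%N then x (j - i)%N else 0.
  rewrite !mxE XE; case: (ltngtP i j) => [lt_ij|lt_ji|eq_ij].
  - by rewrite -val_eqE (ltn_eqF lt_ij) subr0.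
  - by rewrite -val_eqE (gtn_eqF lt_ji) subr0.
  - by rewrite (val_inj eq_ij) eqxx subnn subrr.
have ex_k : exists k, (0 < k <= n)%N && (x k != 0).
  have [/existsP[k /andP[k_gt0 nz]]|/existsPn x0] :=
    boolP [exists k : 'I_n.+1, (0 < k)%N && (x k != 0)].
    by exists k; rewrite k_gt0 -ltnS ltn_ord.
  case/negP: nsX; apply/is_scalar_mxP; exists (x 0).
  apply/eqP; rewrite -subr_eq0; apply/eqP/matrixP => i j; rewrite X'E [RHS]mxE.
  case: ifP => // lt_ij.
  have lt_k : (j - i < n.+1)%N by apply: leq_ltn_trans (leq_subr _ _) _.
  by have := x0 (Ordinal lt_k); rewrite subn_gt0 lt_ij negbK /= => /eqP.
case: (ex_minnP ex_k) => k /andP[k_bnd nz_xk] min_k.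
exists (x 0), k; split=> // i j Dj; rewrite X'E.
  case: ifP => // lt_ij; apply: contraTeq Dj => nz; rewrite -leqNgt.
  have := ltn_ord j; have := min_k (j - i)%N.
  by rewrite nz subn_gt0 lt_ij /=; lia.
by rewrite Dj -{1}[i : nat]addn0 ltn_add2l addKn; case/andP: k_bnd => ->.
Qed.

(** Some column [i] of [X'] is zero, hence by commutation so is column [i] of [X' *m Y']. But if [m]
    is the last row where column [i] of [Y'] is nonzero, only [s = m] contributes to entry (m - k,
    i), and its term is nonzero. *)
Lemma jordan_comm_trmx X Y : comm_mx jordan_mx X -> comm_mx jordan_mx Y^T ->
  comm_mx X Y -> is_scalar_mx X || is_scalar_mx Y.
Proof.
move=> cX cY cXY; apply: contraT; rewrite negb_or => /andP[nsX nsY].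
have nsYT : ~~ is_scalar_mx Y^T.
  apply: contra nsY => /is_scalar_mxP[a Da]; apply/is_scalar_mxP; exists a.
  by rewrite -[Y]trmxK Da tr_scalar_mx.
have [c [k [/andP[k_gt0 k_le] X0 Xk]]] := jordan_comm_band cX nsX.
have [d [l [/andP[l_gt0 l_le] _ Yl]]] := jordan_comm_band cY nsYT.
set X' := X - c%:M in X0 Xk; pose Y' := Y - d%:M.
have cXY' : comm_mx X' Y'.
  apply: comm_mxB (comm_mx_scalar _ _); apply/comm_mx_sym.
  exact: comm_mxB (comm_mx_sym cXY) (comm_mx_scalar _ _).
have Y'l (i j : 'I_n.+1) : i = (j + l)%N :> nat -> Y' i j != 0.
  by move/Yl; rewrite !mxE [i == j]eq_sym.
(* [i < k] makes column [i] of [X'] vanish, and [i + l <= n] puts a nonzero entry of [Y'] in that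
   column at row [m0 = i + l], which is at least [k]. *)
have lt_i : (minn k.-1 (n - l) < n.+1)%N by lia.
have lt_m : (minn k.-1 (n - l) + l < n.+1)%N by lia.
pose i := Ordinal lt_i; pose m0 := Ordinal lt_m.
have XY0 r : (X' *m Y') r i = 0.
  by rewrite cXY' mxE big1 // => s _; rewrite X0 ?mulr0 //=; lia.
have nz0 : Y' m0 i != 0 by apply: Y'l.
pose m := [arg max_(m > m0 | Y' m i != 0) (m : nat)].
have [nz_m max_m] : Y' m i != 0 /\ forall s, Y' s i != 0 -> (s <= m)%N.
  by rewrite /m; case: arg_maxnP.
have le_km : (k <= m)%N by apply: leq_trans (max_m _ nz0); rewrite /=; lia.
have lt_r : (m - k < n.+1)%N by apply: leq_ltn_trans (leq_subr _ _) _.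
have /eqP := XY0 (Ordinal lt_r).
rewrite mxE (bigD1 m) //= big1 ?addr0 => [|s neq_sm].
  by rewrite mulf_eq0 (negPf nz_m) orbF (negPf (Xk _ _ _)) //= subnK.
have [le_ms|lt_sm] := leqP m s; last by rewrite X0 ?mul0r //= subnK.
have [->|/max_m le_sm] := eqVneq (Y' s i) 0; first by rewrite mulr0.
by case/eqP: neq_sm; apply/val_inj/eqP; rewrite /= eqn_leq le_sm le_ms.
Qed.

End Jordan.

(** * Walks in the commuting graph *)

Section Walk.
Variable G : sgraph.
Implicit Types x y z : carrier G.

Lemma walk_vertex k x y : walk k x y -> vertex x /\ vertex y.
Proof.
elim=> [z vz|j u v w Guv _ [_ vw]]; first by [].
by split=> //; have [] := adj_vertex Guv.
Qed.

Lemma walk0_inv x y : walk 0 x y -> x = y.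
Proof. by move=> W; inversion W. Qed.

Lemma walkS_inv k x z : walk k.+1 x z -> exists2 y, adj x y & walk k y z.
Proof. by move=> W; inversion W; exists y. Qed.

Lemma walk_cat j k x y z : walk j x y -> walk k y z -> walk (j + k) x z.
Proof.
by elim=> [//|i u v w Guv _ IHw] /IHw; rewrite addSn; apply: walk_cons Guv.
Qed.

End Walk.

Section CommutingGraph.
Variables (F : fieldType) (n : nat).
Implicit Types A B : 'M[F]_n.+1.
Local Notation G := (commuting_graph F n.+1).

Lemma commuting_vertexP A : vertex (s := G) A <-> ~~ is_scalar_mx A.
Proof.
split=> [vA | nsA cA].
  apply/negP=> /is_scalar_mxP[a Da]; apply: vA => B; rewrite Da.
  exact: comm_scalar_mx.
by case/negP: nsA; apply: central_is_scalar => i j; apply: cA.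
Qed.

(** The length is only bounded because adjacency excludes [A = B], where the empty walk is taken. *)
Lemma commuting_walk A B : ~~ is_scalar_mx A -> ~~ is_scalar_mx B ->
  comm_mx A B -> exists2 k, (k <= 1)%N & walk (G := G) k A B.
Proof.
move=> /commuting_vertexP vA /commuting_vertexP vB cAB.
have [<-|/eqP neqAB] := eqVneq A B; first by exists 0%N => //; apply: walk_nil.
by exists 1%N => //; apply: (@walk_cons G 0 A B B); [split | apply: walk_nil].
Qed.

(** Shorter walks are padded by repeating a vertex, since a matrix commutes with itself. *)
Lemma walk_commuting A B k : walk (G := G) k A B -> (k <= 3)%N ->
  exists X Y, [/\ ~~ is_scalar_mx X, ~~ is_scalar_mx Y,
    comm_mx A X, comm_mx X Y & comm_mx Y B].
Proof.
move=> W; have [/commuting_vertexP nsA /commuting_vertexP nsB] := walk_vertex W.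
case: k W => [/walk0_inv <-|k /walkS_inv[X [_ vX _ cAX] W]].
  by exists A, A.
have nsX := (commuting_vertexP X).1 vX.
case: k W => [/walk0_inv <-|k /walkS_inv[Y [_ vY _ cXY] W]].
  by exists A, X.
have nsY := (commuting_vertexP Y).1 vY.
case: k W => [/walk0_inv <-|k /walkS_inv[Z [_ vZ _ cYZ] W]].
  by exists X, Y.
by case: k W => // /walk0_inv <- _; exists X, Y.
Qed.

Lemma jordan_walk k : (1 < n)%N ->
  walk (G := G) k (jordan_mx F n) (jordan_mx F n)^T -> (4 <= k)%N.
Proof.
move=> n_gt1 W; rewrite leqNgt; apply/negP=> lt_k.
have [X [Y [nsX nsY cJX cXY cYJ]]] := walk_commuting W lt_k.
have cJY : comm_mx (jordan_mx F n) Y^T.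
  by apply: trmx_inj; rewrite !trmx_mul trmxK.
by have := jordan_comm_trmx cJX cJY cXY; rewrite (negPf nsX) (negPf nsY).
Qed.

Lemma jordan_nonscalar : (0 < n)%N -> ~~ is_scalar_mx (jordan_mx F n).
Proof.
move=> n_gt0; apply/negP=> /is_scalar_mxP[a].
move/matrixP/(_ 0 (Ordinal (n_gt0 : (1 < n.+1)%N))); rewrite !mxE /= mulr0n.
by move/eqP; rewrite oner_eq0.
Qed.

Lemma commuting_walk_le4 A B : (1 < n)%N ->
    has_quadratic_factors F ->
    ~~ is_scalar_mx A -> ~~ is_scalar_mx B ->
  exists2 k, (k <= 4)%N & walk (G := G) k A B.
Proof.
move=> n_gt1 irrF nsA nsB.
have [P [nsP cAP sqP]] := idempotent_or_nilpotent_neighbour n_gt1 irrF nsA.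
have [Q [nsQ cBQ sqQ]] := idempotent_or_nilpotent_neighbour n_gt1 irrF nsB.
have [Z [nsZ cPZ cQZ]] : common_neighbour P Q.
  have scale_sq (R : 'M[F]_n.+1) :
      R * R = R \/ R * R = 0 -> exists c, R * R = c *: R.
    by case=> ->; [exists 1; rewrite scale1r | exists 0; rewrite scale0r].
  have [[p PP] [q QQ]] := (scale_sq P sqP, scale_sq Q sqQ).
  case: sqP => [PP1|PP0].
    exact (common_neighbour_idempotent n_gt1 nsP PP1 QQ).
  (* When only [Q] is idempotent, the roles of [P] and [Q] are exchanged. *)
  case: sqQ => [QQ1|QQ0]; last exact: common_neighbour_nilpotent.
  have [Z [nsZ cQZ cPZ]] := common_neighbour_idempotent n_gt1 nsQ QQ1 PP.
  by exists Z.
have [a le_a Wa] := commuting_walk nsA nsP cAP.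
have [b le_b Wb] := commuting_walk nsP nsZ cPZ.
have [c le_c Wc] := commuting_walk nsZ nsQ (esym cQZ).
have [d le_d Wd] := commuting_walk nsQ nsB (esym cBQ).
exists (a + (b + (c + d)))%N; first by lia.
exact: walk_cat Wa (walk_cat Wb (walk_cat Wc Wd)).
Qed.

End CommutingGraph.

Theorem theorem1p1 (n : nat) (F : fieldType) (L : fieldExtType F)
    (n_ge3 : (3 <= n)%N) (FL_closure : is_algebraic_closure (GRing.in_alg L)) :
  connected (commuting_graph F n) /\ is_diameter (commuting_graph F n) 4.
Proof.
case: n n_ge3 => // n n_gt1; have [closedL _] := FL_closure.
pose G := commuting_graph F n.+1.
have walk4 (A B : 'M[F]_n.+1) : vertex (s := G) A -> vertex (s := G) B ->
    exists2 k, (k <= 4)%N & walk (G := G) k A B.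
  move=> /commuting_vertexP nsA /commuting_vertexP nsB.
  exact: commuting_walk_le4 n_gt1 (closed_quadratic_factors closedL) nsA nsB.
split=> [A B vA vB|].
  by have [k _ W] := walk4 A B vA vB; exists k.
split=> [A B k [W min_k]|e bound_e].
  have [vA vB] := walk_vertex W.
  by have [j le_j /min_k le_k] := walk4 A B vA vB; apply: leq_trans le_j.
have nsJ := jordan_nonscalar F (ltnW n_gt1).
have nsJT : ~~ is_scalar_mx (jordan_mx F n)^T.
  apply: contra nsJ => /is_scalar_mxP[a Da]; apply/is_scalar_mxP; exists a.
  by rewrite -[jordan_mx F n]trmxK Da tr_scalar_mx.
have vJ := (commuting_vertexP _).2 nsJ.
have vJT := (commuting_vertexP _).2 nsJT.
have [k le_k W] := walk4 _ _ vJ vJT.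
apply: (bound_e (jordan_mx F n) (jordan_mx F n)^T); split; last first.
  by move=> j; apply: jordan_walk.
by have /eqP<- : k == 4%N by rewrite eqn_leq le_k (jordan_walk n_gt1 W).
Qed.
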